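(* The groups $\Pi_3(\mathbf{k},\mathbf{k}')$ have the $R_\infty$ property.
   Context: Let $A=[\ell_{ij}]\in\mathrm{SL}(2,\mathbb{Z})$ have trace $>2$. For $\mathbf{x}=(x,y)^t\in\mathbb{Z}^2$ write $\mathbf{a}^{\mathbf{x}}=a_1^xa_2^y$; for an integer matrix $B=[b_{ij}]$ write $B(a_i)=a_1^{b_{1i}}a_2^{b_{2i}}$. Kernels and images of integer matrices are taken on $\mathbb{Z}^2$; parameters lying in quotient groups are given by representatives in $\mathbb{Z}^2$. Let $M=\begin{bmatrix}-1&m\\0&1\end{bmatrix}$ with $m\in\{0,1\}$ and $MAM^{-1}=A^{-1}$, and let $(\mathbf{k},\mathbf{k}'-\mathbf{k})\in\frac{\ker(I-M)}{\mathrm{im}(I+M)}\oplus\frac{\ker(A-M)}{\mathrm{im}(A^{-1}+M)}$. Then $$\Pi_3(\mathbf{k},\mathbf{k}')=\langle a_1,a_2,t,\beta\mid [a_1,a_2]=1,\ ta_it^{-1}=A(a_i),\ \beta a_i\beta^{-1}=M(a_i),\ \beta^2=\mathbf{a}^{\mathbf{k}},\ \beta t\beta^{-1}=\mathbf{a}^{\mathbf{k}'}t^{-1}\rangle.$$ The Reidemeister number $R(\varphi)$ of an endomorphism $\varphi$ of a group $G$ is the number (possibly $\infty$) of equivalence classes of the relation $\alpha\sim\gamma\alpha\varphi(\gamma)^{-1}$ ($\gamma\in G$) on $G$. $G$ has the $R_\infty$ property if $R(\varphi)=\infty$ for every automorphism $\varphi$ of $G$. *)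

(* Defs.v *)
From HB Require Import structures.
From mathcomp Require Import all_boot all_algebra.
From mathcomp Require Import generic_quotient.
From mathcomp Require Import finmap.
From mathcomp Require Import boolp classical_sets cardinality.
From mathcomp Require Import constructive_ereal.

Set Implicit Arguments.
Unset Strict Implicit.
Unset Printing Implicit Defensive.

Import GRing.Theory.
Local Open Scope quotient_scope.

(* The letter (x, false) stands for the generator x, and (x, true) for its
   inverse. *)
Definition word (X : Type) : Type := seq (X * bool).

Definition word_gen (X : Type) (x : X) : word X := [:: (x, false)].

Definition word_inv (X : Type) (w : word X) : word X :=
  rev [seq (l.1, ~~ l.2) | l <- w].

Definition word_pow (X : Type) (x : X) (n : int) : word X :=
  match n with
  | Posz n => nseq n (x, false)
  | Negz n => nseq n.+1 (x, true)
  end.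

Lemma word_invK (X : Type) : involutive (@word_inv X).
Proof.
move=> w; rewrite /word_inv map_rev revK -map_comp -[RHS]map_id.
by apply: eq_map => -[x b] /=; rewrite negbK.
Qed.

(* Equality of words in the group <X | rel>, where rel u v means that u = v is
   one of the defining relations. *)
Inductive pres_eq (X : Type) (rel : word X -> word X -> Prop) :
    word X -> word X -> Prop :=
| pres_rel u v : rel u v -> pres_eq rel u v
| pres_cancel x b : pres_eq rel [:: (x, b); (x, ~~ b)] [::]
| pres_refl u : pres_eq rel u u
| pres_sym u v : pres_eq rel u v -> pres_eq rel v u
| pres_trans u v w : pres_eq rel u v -> pres_eq rel v w -> pres_eq rel u w
| pres_cat u u' v v' :
    pres_eq rel u u' -> pres_eq rel v v' -> pres_eq rel (u ++ v) (u' ++ v').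

Section PresentedGroup.
Variables (X : choiceType) (rel : word X -> word X -> Prop).

Lemma pres_catV (w : word X) : pres_eq rel (w ++ word_inv w) [::].
Proof.
elim: w => [|[x b] w IHw]; first exact: pres_refl.
rewrite /word_inv /= rev_cons -cats1 -/(word_inv w) catA.
apply: pres_trans (pres_cancel rel x b).
apply: (@pres_cat _ _ [:: (x, b)] [:: (x, b)] _ [:: (x, ~~ b)]).
  exact: pres_refl.
by apply: (@pres_cat _ _ _ [::]) => //; exact: pres_refl.
Qed.

Lemma pres_Vcat (w : word X) : pres_eq rel (word_inv w ++ w) [::].
Proof. by rewrite -{2}[w]word_invK; exact: pres_catV. Qed.

Lemma pres_inv_compat (u v : word X) :
  pres_eq rel u v -> pres_eq rel (word_inv u) (word_inv v).
Proof.
move=> uv; rewrite -[word_inv u]cats0 -[word_inv v]cat0s.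
apply: pres_trans (pres_cat (pres_refl _ _) (pres_sym (pres_catV v))) _.
rewrite catA; apply: pres_cat; last exact: pres_refl.
apply: pres_trans (pres_Vcat u).
exact: pres_cat (pres_refl _ _) (pres_sym uv).
Qed.

Definition pres_eqb (u v : seq (X * bool)) : bool := `[< pres_eq rel u v >].

Lemma pres_eqb_refl : reflexive pres_eqb.
Proof. by move=> u; apply/asboolP; exact: pres_refl. Qed.

Lemma pres_eqb_sym : symmetric pres_eqb.
Proof. by move=> u v; apply/asboolP/asboolP; exact: pres_sym. Qed.

Lemma pres_eqb_trans : transitive pres_eqb.
Proof.
by move=> v u w /asboolP uv /asboolP vw; apply/asboolP/(pres_trans uv vw).
Qed.

Canonical pres_eqb_equiv :=
  EquivRel pres_eqb pres_eqb_refl pres_eqb_sym pres_eqb_trans.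

Definition presented : Type := {eq_quot pres_eqb}.

HB.instance Definition _ := Choice.on presented.
HB.instance Definition _ := EqQuotient.on presented.

Definition pres_class (w : word X) : presented := \pi_presented w.

Lemma pres_classP (u v : word X) :
  pres_class u = pres_class v <-> pres_eq rel u v.
Proof. by split=> [/eqmodP/asboolP | uv] //; apply/eqmodP/asboolP. Qed.

Lemma pres_reprK (g : presented) : pres_class (repr g) = g.
Proof. exact: reprK. Qed.

Definition pres_mul (g h : presented) : presented :=
  pres_class (repr g ++ repr h).
Definition pres_inv (g : presented) : presented :=
  pres_class (word_inv (repr g)).
Definition pres_one : presented := pres_class [::].

Lemma pres_mulE (u v : word X) :
  pres_mul (pres_class u) (pres_class v) = pres_class (u ++ v).
Proof. by apply/pres_classP/pres_cat; apply/pres_classP/pres_reprK. Qed.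

Lemma pres_invE (u : word X) :
  pres_inv (pres_class u) = pres_class (word_inv u).
Proof. by apply/pres_classP/pres_inv_compat/pres_classP/pres_reprK. Qed.

Lemma pres_mulA : associative pres_mul.
Proof.
move=> g h k; rewrite -[g]pres_reprK -[h]pres_reprK -[k]pres_reprK.
by rewrite !pres_mulE catA.
Qed.

Lemma pres_mul1g : left_id pres_one pres_mul.
Proof. by move=> g; rewrite -[g]pres_reprK pres_mulE. Qed.

Lemma pres_mulg1 : right_id pres_one pres_mul.
Proof. by move=> g; rewrite -[g]pres_reprK pres_mulE cats0. Qed.

Lemma pres_mulVg : left_inverse pres_one pres_inv pres_mul.
Proof.
move=> g; rewrite -[g]pres_reprK pres_invE pres_mulE.
exact/pres_classP/pres_Vcat.
Qed.

Lemma pres_mulgV : right_inverse pres_one pres_inv pres_mul.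
Proof.
move=> g; rewrite -[g]pres_reprK pres_invE pres_mulE.
exact/pres_classP/pres_catV.
Qed.

HB.instance Definition _ := isGroup.Build presented
  pres_mulA pres_mul1g pres_mulg1 pres_mulVg pres_mulgV.

End PresentedGroup.

Section Reidemeister.
Local Open Scope classical_set_scope.
Local Open Scope group_scope.
Variable G : groupType.

Definition twisted_class (phi : {multiplicative G -> G}) (a : G) : set G :=
  [set b | exists g : G, b = g * a * (phi g)^-1].

Definition twisted_classes (phi : {multiplicative G -> G}) : set (set G) :=
  range (twisted_class phi).

Definition reidemeister_number (phi : {multiplicative G -> G}) : \bar nat :=
  if pselect (finite_set (twisted_classes phi)) is left _
  then (#|` fset_set (twisted_classes phi)|%fset)%:E%E else +oo%E.

Definition R_infty : Prop :=
  forall phi : {multiplicative G -> G},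
    bijective phi -> reidemeister_number phi = +oo%E.

End Reidemeister.

Inductive gen3 : Type := gen_a of 'I_2 | gen_t | gen_beta.

Definition gen3_code (x : gen3) : 'I_2 + bool :=
  match x with
  | gen_a i => inl i
  | gen_t => inr false
  | gen_beta => inr true
  end.

Definition gen3_decode (x : 'I_2 + bool) : gen3 :=
  match x with
  | inl i => gen_a i
  | inr false => gen_t
  | inr true => gen_beta
  end.

Lemma gen3_codeK : cancel gen3_code gen3_decode.
Proof. by case. Qed.

HB.instance Definition _ := Choice.copy gen3 (can_type gen3_codeK).

Local Open Scope ring_scope.

(* Indices are shifted down by one: a_1 and a_2 are gen_a 0 and gen_a 1. *)
Definition word_a (x : 'cV[int]_2) : word gen3 :=
  word_pow (gen_a 0) (x 0 0) ++ word_pow (gen_a 1) (x 1 0).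

Inductive Pi3_rel (A M : 'M[int]_2) (k k' : 'cV[int]_2) :
    word gen3 -> word gen3 -> Prop :=
| Pi3_comm :
    let a1 := word_gen (gen_a 0) in let a2 := word_gen (gen_a 1) in
    Pi3_rel A M k k' (a1 ++ a2 ++ word_inv a1 ++ word_inv a2) [::]
| Pi3_t (i : 'I_2) :
    let a := word_gen (gen_a i) in let t := word_gen gen_t in
    Pi3_rel A M k k' (t ++ a ++ word_inv t) (word_a (col i A))
| Pi3_beta (i : 'I_2) :
    let a := word_gen (gen_a i) in let b := word_gen gen_beta in
    Pi3_rel A M k k' (b ++ a ++ word_inv b) (word_a (col i M))
| Pi3_beta2 :
    let b := word_gen gen_beta in
    Pi3_rel A M k k' (b ++ b) (word_a k)
| Pi3_beta_t :
    let b := word_gen gen_beta in let t := word_gen gen_t in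
    Pi3_rel A M k k' (b ++ t ++ word_inv b) (word_a k' ++ word_inv t).

Definition Pi3 (A M : 'M[int]_2) (k k' : 'cV[int]_2) : groupType :=
  presented (Pi3_rel A M k k').

Definition reflection_mx (m : int) : 'M[int]_2 :=
  \matrix_(i, j) (nth [::] [:: [:: -1; m]; [:: 0; 1]] i)`_j.

(* Main.v *)
Require Import Defs.
From mathcomp Require Import all_boot all_algebra.
From HB Require Import structures.
From mathcomp Require Import boolp classical_sets cardinality.
From mathcomp Require Import constructive_ereal.
From mathcomp Require Import zify ring.
Import GRing.Theory Num.Theory.
Local Open Scope ring_scope.

(** The subgroup [N] generated by [a_1, a_2] is normal, and killing it leaves
    the infinite dihedral group [D = <t, beta | beta^2, beta t beta^-1 = t^-1>].
    The R_infty property of the group is inherited from that of [D], once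
    every automorphism [phi] is known to induce an automorphism of [D].

    To see this, let [proj] be the projection onto [D] and [f = proj o phi],
    which is onto.  No reflection of [D] commutes with the whole image of [f]
    ([dihedral_reflection_commute_gen]), while the centraliser of a reflection
    [r] is only [{1, r}].

    - If some [f a_i] were a reflection [r], then the abelian group [f N] would
      be [{1, r}]; as [t] and [beta] conjugate [N] into itself, [f t] and
      [f beta] would fix [r], so [r] would be central in the image.
    - So [f] maps [a_i] to a translation by some integer [n_i].  Conjugation by
      [t] acts on [N] by [A] and on translations by a sign, hence
      [n A = n] or [n A = - n] for the row [n = (n_1, n_2)].  But
      [det (A -+ 1) = 2 -+ tr A] is nonzero, so [n = 0] and [f] kills [N].
    - Then [f] is determined by [f t] and [f beta].  If [f t] were a reflection,
      the relation [beta t beta^-1 = a^k' t^-1] would make it central; if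
      [f beta] were a translation, the image would contain only translations.
      So [f] is [proj] followed by the endomorphism [t |-> t^p],
      [beta |-> t^j beta] of [D], where [p = 1] or [p = -1], as [f] is onto
      ([epi_factors_dihedral_endo]).

    Such an endomorphism is conjugation by an affine map [psi] of slope [p], so
    twisted conjugacy of [d] and [d'] amounts to [D]-conjugacy of the affine
    maps [d psi] and [d' psi].  If [d] has slope [p], then [d psi] is a
    translation, whose length is a conjugacy invariant; this length
    takes infinitely many values ([dihedral_twisted_conjugacy]). *)

(** * Evaluating words in a group *)

Section WordEvaluation.
Local Open Scope group_scope.
Context {X : choiceType} {H : groupType}.
Implicit Types (u : X -> H) (v w : word X).

Definition letter_eval u (l : X * bool) : H :=
  if l.2 then (u l.1)^-1 else u l.1.

Definition word_eval u w : H := \prod_(l <- w) letter_eval u l.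

Lemma word_eval0 u : word_eval u [::] = 1.
Proof. by rewrite /word_eval big_nil. Qed.

Lemma word_eval1 u x b : word_eval u [:: (x, b)] = letter_eval u (x, b).
Proof. by rewrite /word_eval big_seq1. Qed.

Lemma word_eval_cat u v w :
  word_eval u (v ++ w) = word_eval u v * word_eval u w.
Proof. exact: big_cat. Qed.

Lemma word_eval_closed (P : H -> Prop) u w :
    P 1 -> (forall g h, P g -> P h -> P (g * h)) ->
    (forall x, P (u x)) -> (forall x, P (u x)^-1) ->
  P (word_eval u w).
Proof.
move=> P1 PM Pu PV; rewrite /word_eval; apply: big_ind => // -[x b] _.
by rewrite /letter_eval; case: b => /=.
Qed.

Lemma pres_eq_word_eval (rel : word X -> word X -> Prop) u :
    (forall v w, rel v w -> word_eval u v = word_eval u w) ->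
  forall v w, pres_eq rel v w -> word_eval u v = word_eval u w.
Proof.
move=> u_rel v w.
elim=> {v w} [v w /u_rel //|x b|//|//|v w z _ -> _ -> //|].
  rewrite word_eval0 (word_eval_cat u [:: (x, b)] [:: (x, ~~ b)]) !word_eval1.
  by case: b; rewrite /letter_eval /= ?mulVg ?mulgV.
by move=> v v' w w' _ vv' _ ww'; rewrite !word_eval_cat vv' ww'.
Qed.

(** The universal property of a presentation: an assignment of the generators
    that respects the relations extends to a homomorphism. *)
Lemma pres_lift_exists (rel : word X -> word X -> Prop) u :
    (forall v w, rel v w -> word_eval u v = word_eval u w) ->
  exists f : {multiplicative presented rel -> H},
    forall w, f (pres_class rel w) = word_eval u w.
Proof.
move=> u_rel; pose f (g : presented rel) := word_eval u (repr g).
have fE w : f (pres_class rel w) = word_eval u w.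
  by apply: (pres_eq_word_eval _ _ u_rel); apply/pres_classP/pres_reprK.
have fM : {morph f : g h / g * h}.
  move=> g h; rewrite -[g]pres_reprK -[h]pres_reprK.
  by rewrite [_ * _]pres_mulE !fE word_eval_cat.
pose fM' := isMultiplicative.Build _ _ f fM.
pose F : {multiplicative presented rel -> H} := HB.pack f fM'.
by exists F.
Qed.

Lemma word_eval_gen u x : word_eval u (word_gen x) = u x.
Proof. exact: word_eval1. Qed.

Lemma word_eval_inv u w : word_eval u (word_inv w) = (word_eval u w)^-1.
Proof.
apply: (@mulgI _ (word_eval u w)); rewrite mulgV -word_eval_cat -(word_eval0 u).
(* Cancellation holds already in the free group, the empty presentation. *)
by apply: pres_eq_word_eval (pres_catV (fun _ _ => False) w).
Qed.

Lemma commute_word_eval_pow u g x z :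
  commute g (u x) -> commute g (word_eval u (word_pow x z)).
Proof.
move=> gx; have nat_pow b n : commute g (word_eval u (nseq n (x, b))).
  elim: n => [|n IHn] /=; first by rewrite word_eval0; exact: commute1.
  rewrite -cat1s word_eval_cat word_eval1; apply: commuteM IHn.
  by case: b => //; exact: commuteV.
by case: z => n; exact: nat_pow.
Qed.

Lemma multiplicative1 {G : groupType} (f : {multiplicative G -> H}) : f 1 = 1.
Proof. by apply: (@mulgI _ (f 1)); rewrite -gmulfM !mulg1. Qed.

Lemma multiplicativeV {G : groupType} (f : {multiplicative G -> H}) g :
  f g^-1 = (f g)^-1.
Proof.
by apply: (@mulgI _ (f g)); rewrite -gmulfM !mulgV multiplicative1.
Qed.

(** A homomorphism is determined by its values on the generators. *)
Lemma pres_morph_class (rel : word X -> word X -> Prop)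
    (f : {multiplicative presented rel -> H}) w :
  f (pres_class rel w) = word_eval (fun x => f (pres_class rel (word_gen x))) w.
Proof.
elim: w => [|[x b] w IHw]; first by rewrite word_eval0 -(multiplicative1 f).
rewrite -cat1s word_eval_cat -IHw word_eval1 -[pres_class _ _]pres_mulE gmulfM.
congr (_ * _); case: b; rewrite /letter_eval /=; last by [].
by rewrite -multiplicativeV -[_^-1]/(pres_inv _) pres_invE.
Qed.

End WordEvaluation.

Lemma word_eval_morph {X : choiceType} {H K : groupType}
    (f : {multiplicative H -> K}) (u : X -> H) (w : word X) :
  f (word_eval u w) = word_eval (f \o u) w.
Proof.
elim: w => [|[x b] w IHw]; first by rewrite !word_eval0 multiplicative1.
rewrite -cat1s !word_eval_cat gmulfM IHw !word_eval1.
by case: b; rewrite /letter_eval //= multiplicativeV.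
Qed.

(** * The infinite dihedral group *)

(** The pair [(n, b)] stands for the isometry [x |-> n + x] of the integers if
    [b] is false, and for the reflection [x |-> n - x] if [b] is true. *)
Definition dihedral : Type := (int * bool)%type.
HB.instance Definition _ := Choice.on dihedral.

Definition flip (b : bool) (x : int) : int := if b then - x else x.

Definition dihedral_mul (g h : dihedral) : dihedral :=
  (g.1 + flip g.2 h.1, g.2 (+) h.2).
Definition dihedral_inv (g : dihedral) : dihedral := (- flip g.2 g.1, g.2).
Definition dihedral_one : dihedral := (0, false).

Lemma dihedral_mulA : associative dihedral_mul.
Proof.
move=> [x b] [y c] [z d]; rewrite /dihedral_mul /= addbA; congr pair.
by case: b; case: c => /=; ring.
Qed.

Lemma dihedral_mul1g : left_id dihedral_one dihedral_mul.
Proof. by move=> [x b]; rewrite /dihedral_mul /= add0r. Qed.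

Lemma dihedral_mulg1 : right_id dihedral_one dihedral_mul.
Proof. by move=> [x []]; rewrite /dihedral_mul /= ?oppr0 addr0. Qed.

Lemma dihedral_mulVg : left_inverse dihedral_one dihedral_inv dihedral_mul.
Proof.
by move=> [x []]; rewrite /dihedral_mul /dihedral_inv /= ?opprK ?subrr ?addNr.
Qed.

Lemma dihedral_mulgV : right_inverse dihedral_one dihedral_inv dihedral_mul.
Proof.
by move=> [x []]; rewrite /dihedral_mul /dihedral_inv /= ?opprK ?subrr ?addNr.
Qed.

HB.instance Definition _ := isGroup.Build dihedral
  dihedral_mulA dihedral_mul1g dihedral_mulg1 dihedral_mulVg dihedral_mulgV.

Lemma dihedral_mulE (g h : dihedral) :
  (g * h)%g = (g.1 + flip g.2 h.1, g.2 (+) h.2).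
Proof. by []. Qed.

Lemma dihedral_invE (g : dihedral) : (g^-1)%g = (- flip g.2 g.1, g.2).
Proof. by []. Qed.

Lemma dihedral_oneE : (1 : dihedral)%g = (0, false).
Proof. by []. Qed.

Definition dihedralE := (dihedral_mulE, dihedral_invE, dihedral_oneE).

(** The endomorphism that maps the translation by [1] to the translation by [p]
    and the reflection [(0, true)] to [(j, true)]. *)
Definition dihedral_endo (p j : int) (g : dihedral) : dihedral :=
  (p * g.1 + (if g.2 then j else 0), g.2).

Lemma dihedral_endoM (p j : int) :
  {morph dihedral_endo p j : g h / (g * h)%g}.
Proof.
move=> [x b] [y c]; rewrite /dihedral_endo !dihedralE /=; congr pair.
by case: b; case: c => /=; ring.
Qed.

HB.instance Definition _ (p j : int) :=
  isMultiplicative.Build dihedral dihedral (dihedral_endo p j)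
    (dihedral_endoM p j).

Lemma dihedral_endo_hits_generator (p j : int) (g : dihedral) :
  dihedral_endo p j g = (1, false) -> p = 1 \/ p = -1.
Proof.
case: g => x [] // [] /=; rewrite addr0 => px1.
have : (`|p| * `|x|)%N = 1%N by rewrite -abszM px1.
by move/eqP; rewrite muln_eq1 => /andP[/eqP p1 _]; lia.
Qed.

Lemma dihedral_reflection_commute (x : int) (h : dihedral) :
  commute ((x, true) : dihedral) h -> h = 1%g \/ h = (x, true).
Proof.
case: h => y [] /(congr1 (fun g : dihedral => g.1)); rewrite !dihedralE /=.
  by move=> e; right; congr pair; lia.
by move=> e; left; congr pair; lia.
Qed.

(** No reflection is central in the infinite dihedral group, so none commutes
    with a generating family. *)
Lemma dihedral_reflection_commute_gen {X : choiceType} (u : X -> dihedral)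
    (x : int) :
  (forall d : dihedral, exists w, word_eval u w = d) ->
  ~ (forall y, commute ((x, true) : dihedral) (u y)).
Proof.
move=> u_surj comm_u; have [w uw] := u_surj (1, false).
have: commute ((x, true) : dihedral) (word_eval u w).
  apply: (word_eval_closed (commute ((x, true) : dihedral))).
  - exact: commute1.
  - by move=> g h; exact: commuteM.
  - exact: comm_u.
  - by move=> y; apply: commuteV.
by rewrite uw => /dihedral_reflection_commute [].
Qed.

Lemma word_eval_pow_translation {X : choiceType} {u : X -> dihedral} {x : X}
    {n : int} (z : int) :
  u x = (n, false) -> word_eval u (word_pow x z) = (n * z, false).
Proof.
move=> ux.
have nat_pow b k : word_eval u (nseq k (x, b)) = (n * flip b k%:Z, false).
  elim: k => [|k IHk] /=.
    by rewrite word_eval0; case: b; rewrite /= ?oppr0 mulr0.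
  rewrite -cat1s word_eval_cat IHk word_eval1 /letter_eval /= ux.
  by case: (b); rewrite !dihedralE /=; congr pair; lia.
by case: z => k; rewrite /word_pow nat_pow /=; congr pair; lia.
Qed.

(** Conjugation by the affine map [psi : x |-> p * x + j / 2] restricts to
    [dihedral_endo p j].  The elements [(n, p == -1)] are those that become
    translations after composition with [psi], by [n + p * j / 2].  Conjugation
    can only change the sign of that number, and the offset [`|j|] makes all
    those considered nonnegative. *)
Lemma dihedral_twisted_conjugacy (p j : int) (x y : nat) (g : dihedral) :
    p = 1 \/ p = -1 ->
    ((`|j|%N + x)%N%:Z, p == -1) =
      (g * (((`|j|%N + y)%N%:Z, p == -1) : dihedral) / dihedral_endo p j g)%g ->
  x = y.
Proof.
by case: g => z [] [] ->; rewrite /dihedral_endo !dihedralE /= => -[]; lia.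
Qed.

(** * The groups Pi3 and their dihedral quotient *)

Definition Pi3_dihedral_gen (x : gen3) : dihedral :=
  match x with
  | gen_a _ => (0, false)
  | gen_t => (1, false)
  | gen_beta => (0, true)
  end.

Lemma word_eval_a_translation (u : gen3 -> dihedral) (n : 'I_2 -> int)
    (x : 'cV[int]_2) :
  (forall i, u (gen_a i) = (n i, false)) ->
  word_eval u (word_a x) = (n 0 * x 0 0 + n 1 * x 1 0, false).
Proof.
move=> ua; rewrite word_eval_cat.
by rewrite !(word_eval_pow_translation _ (ua _)) dihedralE.
Qed.

Lemma Pi3_relP {H : groupType} (A M : 'M[int]_2) (k k' : 'cV[int]_2)
    (u : gen3 -> H) :
  (forall v w, Pi3_rel A M k k' v w -> word_eval u v = word_eval u w) <->
  [/\ commute (u (gen_a 0)) (u (gen_a 1)),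
      forall i, (u gen_t * u (gen_a i) / u gen_t)%g
        = word_eval u (word_a (col i A)),
      forall i, (u gen_beta * u (gen_a i) / u gen_beta)%g
        = word_eval u (word_a (col i M)),
      (u gen_beta * u gen_beta)%g = word_eval u (word_a k) &
      (u gen_beta * u gen_t / u gen_beta)%g
        = (word_eval u (word_a k') / u gen_t)%g].
Proof.
split=> [u_rel | [u_comm u_t u_beta u_beta2 u_beta_t] v w].
  split.
  - have := u_rel _ _ (Pi3_comm A M k k'); cbv zeta.
    rewrite !word_eval_cat !word_eval_inv !word_eval_gen word_eval0.
    by rewrite mulgA -invgM => /mulg1_eq/invg_inj.
  - move=> i; rewrite -(u_rel _ _ (Pi3_t A M k k' i)).
    by rewrite !word_eval_cat word_eval_inv !word_eval_gen mulgA.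
  - move=> i; rewrite -(u_rel _ _ (Pi3_beta A M k k' i)).
    by rewrite !word_eval_cat word_eval_inv !word_eval_gen mulgA.
  - by rewrite -(u_rel _ _ (Pi3_beta2 A M k k')) word_eval_cat word_eval_gen.
  - have := u_rel _ _ (Pi3_beta_t A M k k'); cbv zeta.
    rewrite (word_eval_cat u (word_a k')).
    by rewrite !word_eval_cat !word_eval_inv !word_eval_gen mulgA.
case; cbv zeta => *.
- rewrite !word_eval_cat !word_eval_inv !word_eval_gen word_eval0.
  by rewrite mulgA -invgM u_comm mulgV.
- by rewrite -u_t !word_eval_cat word_eval_inv !word_eval_gen mulgA.
- by rewrite -u_beta !word_eval_cat word_eval_inv !word_eval_gen mulgA.
- by rewrite -u_beta2 word_eval_cat word_eval_gen.
- rewrite (word_eval_cat u (word_a k')) word_eval_inv word_eval_gen -u_beta_t.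
  by rewrite !word_eval_cat word_eval_inv !word_eval_gen mulgA.
Qed.

Lemma Pi3_dihedral_rel (A M : 'M[int]_2) (k k' : 'cV[int]_2) v w :
  Pi3_rel A M k k' v w ->
  word_eval Pi3_dihedral_gen v = word_eval Pi3_dihedral_gen w.
Proof.
move: v w; apply/Pi3_relP.
have a1 x : word_eval Pi3_dihedral_gen (word_a x) = (0, false).
  by rewrite (word_eval_a_translation _ (fun=> 0)) // !mul0r.
by split=> *; rewrite ?a1.
Qed.

Lemma ord2_ind (P : 'I_2 -> Prop) : P 0 -> P 1 -> forall i, P i.
Proof.
move=> P0 P1 [[|[|//]] i_lt2].
  by rewrite (_ : Ordinal _ = 0) //; exact: val_inj.
by rewrite (_ : Ordinal _ = 1) //; exact: val_inj.
Qed.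

(** [A] has no eigenvalue [1] or [-1]: the characteristic polynomial
    [X^2 - (tr A) X + 1] takes the values [2 - tr A] and [2 + tr A] there. *)
Lemma row_eigenvector0 (A : 'M[int]_2) (n : 'I_2 -> int) (b : bool) :
    \det A = 1 -> 2 < \tr A ->
    (forall i, flip b (n i) = n 0 * A 0 i + n 1 * A 1 i) ->
  forall i, n i = 0.
Proof.
move=> detA trA nA.
have i1 : lift ord0 ord0 = 1 :> 'I_2 by exact: val_inj.
have {}detA : A 0 0 * A 1 1 - A 0 1 * A 1 0 = 1.
  have l10 : lift 1 0 = 0 :> 'I_2 by exact: val_inj.
  rewrite -detA (expand_det_row _ 0) !big_ord_recl big_ord0 /cofactor.
  by rewrite !det_mx11 !mxE i1 l10 /= expr0 expr1; ring.
have {}trA : A 0 0 + A 1 1 > 2.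
  by move: trA; rewrite /mxtrace !big_ord_recl big_ord0 i1 addr0.
pose s : int := if b then -1 else 1.
have s2 : s * s = 1 by rewrite /s; case: (b).
have flipE x : flip b x = s * x.
  by rewrite /s; case: (b); rewrite /= ?mulN1r ?mul1r.
have n0 i : n i * (2 - s * (A 0 0 + A 1 1)) = 0 -> n i = 0.
  move/eqP; rewrite mulf_eq0 => /orP[/eqP //|].
  by rewrite /s; case: (b) => /eqP; lia.
have e0 : n 0 * (A 0 0 - s) + n 1 * A 1 0 = 0.
  by rewrite mulrBr -[_ * s]mulrC -flipE nA; ring.
have e1 : n 0 * A 0 1 + n 1 * (A 1 1 - s) = 0.
  by rewrite mulrBr -[_ * s]mulrC -flipE nA; ring.
(* By Cramer's rule each coordinate is killed by [det (A - s)], which equals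
   [2 - s * tr A] since [s * s = det A = 1]. *)
have n00 : n 0 = 0.
  apply: n0; rewrite -[2]/(1 + 1) -{1}detA -s2.
  transitivity ((A 1 1 - s) * 0 - A 1 0 * 0 : int).
    by rewrite -{1}e0 -e1; ring.
  by rewrite !mulr0 subrr.
have n10 : n 1 = 0.
  apply: n0; rewrite -[2]/(1 + 1) -{1}detA -s2.
  transitivity ((A 0 0 - s) * 0 - A 0 1 * 0 : int).
    by rewrite -{1}e1 -e0; ring.
  by rewrite !mulr0 subrr.
exact: ord2_ind.
Qed.

(** * Epimorphisms from Pi3 to the infinite dihedral group *)

Section EpimorphismToDihedral.
Context (A M : 'M[int]_2) (k k' : 'cV[int]_2) (u : gen3 -> dihedral).
Hypothesis detA : \det A = 1.
Hypothesis trA : 2 < \tr A.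
Hypothesis u_rel : forall v w, Pi3_rel A M k k' v w ->
  word_eval u v = word_eval u w.
Hypothesis u_surj : forall d : dihedral, exists w, word_eval u w = d.

(** If [a_i] went to a reflection, that reflection would be central in the
    image: the image of the group generated by the [a_j] lies in its
    centraliser, and [t] and [beta] conjugate that group into itself. *)
Lemma epi_a_translation i : (u (gen_a i)).2 = false.
Proof.
have [u_comm u_t u_beta _ _] := (Pi3_relP _ _ _ _ _).1 u_rel.
case uai: (u (gen_a i)) => [x [|//]] /=; exfalso.
set r : dihedral := (x, true) in uai.
have ra j : commute r (u (gen_a j)).
  by rewrite -uai; move: i j {uai}; do 2!apply: ord2_ind.
have rconj g j (B : 'M_2) :
    (g * u (gen_a i) / g)%g = word_eval u (word_a (col j B)) -> commute r g.
  move=> gE; have : commute r (g * r / g)%g.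
    rewrite -uai gE uai; rewrite word_eval_cat.
    by apply: commuteM; apply: commute_word_eval_pow.
  (* A conjugate of [r] that commutes with [r] is [r] itself. *)
  case/dihedral_reflection_commute => [/(congr1 snd)|grg].
    by rewrite !dihedralE /=; case: (g.2).
  by move/(congr1 (fun h => (h * g)%g)): grg; rewrite mulgVK.
apply: (dihedral_reflection_commute_gen u x u_surj) => -[j||].
- exact: ra.
- exact: rconj (u_t i).
- exact: rconj (u_beta i).
Qed.

(** Conjugation by [t] multiplies the row of translation lengths by [A] on one
    side and by a sign on the other, so this row is an eigenvector. *)
Lemma epi_a_trivial i : u (gen_a i) = (0, false).
Proof.
have [_ u_t _ _ _] := (Pi3_relP _ _ _ _ _).1 u_rel.
have ua j : u (gen_a j) = ((u (gen_a j)).1, false).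
  by rewrite -(epi_a_translation j) -surjective_pairing.
rewrite ua; congr pair; move: i.
apply: (row_eigenvector0 A _ (u gen_t).2) => // i.
have /(congr1 fst) := u_t i.
rewrite (word_eval_a_translation u _ _ ua) !mxE /= => <-.
by rewrite epi_a_translation addbF; case: (u gen_t) => z [] /=; lia.
Qed.

(** [beta] conjugates the image of [t] to its inverse; a reflection is its own
    inverse, so it would be central. *)
Lemma epi_t_translation : (u gen_t).2 = false.
Proof.
have [_ _ _ _ u_beta_t] := (Pi3_relP _ _ _ _ _).1 u_rel.
case ut: (u gen_t) => [x [|//]] /=; exfalso.
apply: (dihedral_reflection_commute_gen u x u_surj) => -[j||].
- by rewrite epi_a_trivial; exact: commute1.
- by rewrite ut.
- move: u_beta_t; rewrite (word_eval_a_translation u (fun=> 0)) ?ut;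
    last exact: epi_a_trivial.
  case: (u gen_beta) => y c; rewrite /commute !dihedralE /= !mul0r => -[e].
  by move: e; case: c => /= e _; congr pair; lia.
Qed.

Lemma epi_beta_reflection : (u gen_beta).2 = true.
Proof.
case ub: (u gen_beta).2 => //; have [w uw] := u_surj (0, true).
have : (word_eval u w).2 = false.
  apply: (word_eval_closed (fun d : dihedral => d.2 = false)) => //.
  - by move=> [x []] [y []].
  - by move=> [i||]; rewrite ?epi_a_trivial ?epi_t_translation.
  - by move=> [i||]; rewrite /= ?epi_a_trivial ?epi_t_translation.
by rewrite uw.
Qed.

(** With the [a_i] killed, [t] sent to a translation and [beta] to a
    reflection, the two sides agree on the generators; [p] is a unit because
    the translation by [1] is attained. *)
Lemma epi_factors_dihedral_endo : exists p j : int, (p = 1 \/ p = -1) /\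
  forall w, word_eval u w = dihedral_endo p j (word_eval Pi3_dihedral_gen w).
Proof.
pose p := (u gen_t).1; pose j := (u gen_beta).1; exists p, j.
have uE w : word_eval u w = dihedral_endo p j (word_eval Pi3_dihedral_gen w).
  rewrite word_eval_morph; congr word_eval; apply: funext => -[i||] /=.
  - by rewrite epi_a_trivial /dihedral_endo /= mulr0 addr0.
  - rewrite /dihedral_endo /= mulr1 addr0.
    by rewrite -epi_t_translation -surjective_pairing.
  - rewrite /dihedral_endo /= mulr0 add0r.
    by rewrite -epi_beta_reflection -surjective_pairing.
split=> //; have [w uw] := u_surj (1, false).
apply: (dihedral_endo_hits_generator p j (word_eval Pi3_dihedral_gen w)).
by rewrite -uE.
Qed.

End EpimorphismToDihedral.

(** * The Reidemeister number *)

Lemma infinite_reidemeister (G : groupType) (phi : {multiplicative G -> G})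
    (c : nat -> G) :
    (forall x y g, c x = (g * c y / phi g)%g -> x = y) ->
  reidemeister_number phi = +oo%E.
Proof.
move=> c_inj; rewrite /reidemeister_number; case: pselect => // fin; exfalso.
apply: infinite_nat.
have := @finite_preimage _ _ (twisted_classes phi)
  (fun x => twisted_class phi (c x)).
rewrite (_ : (_ @^-1` _ = setT)%classic); last first.
  by apply/seteqP; split=> // x _; exists (c x).
apply=> // x y _ _ cxy.
have : twisted_class phi (c x) (c x).
  by exists 1%g; rewrite multiplicative1 invg1 mulg1 mul1g.
by rewrite cxy => -[g /c_inj].
Qed.

Theorem theorem5p2 (A : 'M[int]_2) (m : int) (k k' : 'cV[int]_2)
    (detA : \det A = 1) (trA : 2 < \tr A)
    (m01 : m = 0 \/ m = 1)
    (MA : reflection_mx m *m A *m invmx (reflection_mx m) = invmx A)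
    (kerk : (1%:M - reflection_mx m) *m k = 0)
    (kerk' : (A - reflection_mx m) *m (k' - k) = 0) :
  R_infty (Pi3 A (reflection_mx m) k k').
Proof.
move=> phi [phi' _ phiK].
set rel := Pi3_rel A (reflection_mx m) k k'.
have [proj projE] := pres_lift_exists rel Pi3_dihedral_gen
  (Pi3_dihedral_rel A (reflection_mx m) k k').
have proj_surj (d : dihedral) : exists g, proj g = d.
  case: d => x b.
  exists (pres_class rel (word_pow gen_t x ++ nseq b (gen_beta, false))).
  rewrite projE word_eval_cat (word_eval_pow_translation (n := 1)) //.
  case: b; rewrite ?word_eval1 ?word_eval0 /letter_eval !dihedralE /=;
    by congr pair; lia.
pose u x := proj (phi (pres_class rel (word_gen x))).
have uE w : proj (phi (pres_class rel w)) = word_eval u w.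
  exact: (pres_morph_class rel (proj \o phi)).
have u_rel v w : rel v w -> word_eval u v = word_eval u w.
  by move=> vw; rewrite -!uE (_ : pres_class rel v = pres_class rel w) //;
    apply/pres_classP/pres_rel.
have u_surj d : exists w, word_eval u w = d.
  have [g <-] := proj_surj d; exists (repr (phi' g)).
  by rewrite -uE pres_reprK phiK.
have [p [j [p1 u_endo]]] :=
  epi_factors_dihedral_endo A _ k k' u detA trA u_rel u_surj.
(* Twisted conjugacy in the group projects to twisted conjugacy under
   [dihedral_endo p j], which separates the images of the [c x]. *)
have [c cE] := choice (fun x : nat => proj_surj ((`|j|%N + x)%N%:Z, p == -1)).
apply: (infinite_reidemeister _ phi c) => x y g /(congr1 proj).
rewrite !gmulfM multiplicativeV !cE -[in phi g](pres_reprK g) uE u_endo -projE.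
by rewrite pres_reprK; exact: dihedral_twisted_conjugacy.
Qed.
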